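(* Let $\Delta>0$. For $\lambda>0$ and $\gamma_0,\gamma_1>0$ let $\mathcal{R}_\lambda(\gamma_0,\gamma_1)$ denote the asymptotic misclassification error of $\ell_2$-regularized linear discriminant analysis with balanced test priors (explicit formula in the context), and for $\gamma>0$ write $\mathcal{R}_\lambda(\gamma):=\mathcal{R}_\lambda(2\gamma,2\gamma)$. Then $\frac{\partial}{\partial\gamma}\mathcal{R}_\lambda(\gamma)$ is positive only when one of the following cases happens: (1) $0<\gamma\le1$ and $\lambda>0$; (2) $\gamma\ge\frac{\sqrt{\Delta^2+4}}{2}+1$ and $\lambda>0$; (3) $1<\gamma<\frac{\sqrt{\Delta^2+4}}{2}+1$ and $\lambda\ge$ the smallest real root $x$ of the quartic $$\begin{aligned}&x^4(32\gamma+4\Delta^2)+x^3(96\gamma^2+8\gamma\Delta^2+128\gamma+16\Delta^2)\\&+x^2(96\gamma^3+112\gamma^2+16\gamma\Delta^2+192\gamma+\Delta^4+24\Delta^2)\\&+x(-8\gamma^3\Delta^2-16\gamma^2\Delta^2+32\gamma^4-96\gamma^3-64\gamma^2-2\gamma\Delta^4+8\gamma\Delta^2+128\gamma+2\Delta^4+16\Delta^2)\\&-4\gamma^4\Delta^2+16\gamma^3\Delta^2+\gamma^2\Delta^4-16\gamma^2\Delta^2-16\gamma^4+64\gamma^3-80\gamma^2-2\gamma\Delta^4+32\gamma+\Delta^4+4\Delta^2 .\end{aligned}$$ Consequently, the balanced error $\mathcal{R}_\lambda(\gamma)$ increases as $\gamma$ grows in $(0,1)$ or in $\left(\frac{\sqrt{\Delta^2+4}}{2}+1,\infty\right)$.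 As $\gamma$ grows in $\left(1,\frac{\sqrt{\Delta^2+4}}{2}+1\right)$, it decreases when $\lambda$ is small and increases when $\lambda$ is large. With strong regularization the phase transition vanishes: for all sufficiently large $\lambda$, $$\frac{\partial}{\partial\gamma_1}\mathcal{R}_\lambda(\gamma_0,\gamma_1)\Big|_{\gamma_0=\gamma_1=2\gamma}>0\quad\text{for every }\gamma>0.$$ For example, when $\Delta^2=9$ and $\lambda=1$, $\mathcal{R}_\lambda(\gamma)$ increases monotonically with respect to $\gamma$, and $\frac{\partial}{\partial\gamma_1}\mathcal{R}_\lambda(\gamma_0,\gamma_1)\big|_{\gamma_1=\gamma_0}>0$ for any $\gamma_0>0$.
   Context: $\Phi$ is the CDF of the standard normal distribution. $\gamma_\ell$ is the limit of (dimension)/(number of training samples in class $\ell$), and $\Delta^2$ is the asymptotic signal-to-noise ratio $(\mu_0-\mu_1)^\top\Sigma^{-1}(\mu_0-\mu_1)$ of the two Gaussian classes $N(\mu_\ell,\Sigma)$. $\lambda$ is the regularization parameter in $\hat\beta_\lambda=(\hat\Sigma+\lambda I)^{-1}(\hat\mu_0-\hat\mu_1)$, where $\hat\mu_\ell$ are the sample means and $\hat\Sigma$ is the pooled sample covariance. For $\gamma_0,\gamma_1>0$ put $\gamma=\frac{\gamma_0\gamma_1}{\gamma_0+\gamma_1}$ (so $\gamma_0=\gamma_1=2\gamma$ in the balanced case), $g(\gamma_0,\gamma_1,\ell)=-\frac12(\Delta^2+(-1)^\ell(\gamma_1-\gamma_0))$ and $k(\gamma_0,\gamma_1)=\sqrt{\Delta^2+\gamma_0+\gamma_1}$.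 Let $m(\zeta)=\int\frac1{s-\zeta}\,dF_\gamma(s)$ be the Stieltjes transform of the Marchenko–Pastur law $F_\gamma$ with ratio $\gamma$, and $m'$ its derivative in $\zeta$; explicitly, for $\lambda>0$, $$m(-\lambda)=\frac{\sqrt{(\gamma+\lambda+1)^2-4\gamma}+\gamma-\lambda-1}{2\gamma\lambda},\qquad m'(-\lambda)=-\frac{\partial}{\partial\lambda}\big[m(-\lambda)\big].$$ Then $$\mathcal{R}_\lambda(\gamma_0,\gamma_1)=\frac12\sum_{\ell=0,1}\Phi\left(\frac{g(\gamma_0,\gamma_1,\ell)\,m(-\lambda)+(-1)^\ell\ln\frac{\gamma_0}{\gamma_1}}{k(\gamma_0,\gamma_1)\sqrt{m'(-\lambda)}}\right),$$ and in the balanced case $$\mathcal{R}_\lambda(\gamma)=\mathcal{R}_\lambda(2\gamma,2\gamma)=\Phi\left(\frac{-\Delta^2m(-\lambda)}{2\sqrt{(\Delta^2+4\gamma)\,m'(-\lambda)}}\right).$$ Both $m(-\lambda)$ and $m'(-\lambda)$ depend on $\gamma$, hence on $\gamma_0,\gamma_1$. ''Phase transition'' refers to the sign of $\frac{\partial}{\partial\gamma_1}\mathcal{R}_\lambda$ at the balanced point changing as $\gamma_0$ varies.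
   Formalization: The claim that the balanced error decreases on (1, √(Δ²+4)/2+1) for small λ is stated on each closed subinterval [a,b], with the bound on λ depending on a and b; no single λ>0 works on the whole interval, since the derivative is positive near γ=1. *)

(* Defs.v *)
From HB Require Import structures.
From mathcomp Require Import all_boot all_order all_algebra.
From mathcomp Require Import all_classical all_reals all_analysis.

Set Implicit Arguments.
Unset Strict Implicit.
Unset Printing Implicit Defensive.

Import Order.TTheory GRing.Theory Num.Theory.
Import numFieldNormedType.Exports.

Local Open Scope classical_set_scope.
Local Open Scope ring_scope.

Section Defs.
Context {R : realType}.
Implicit Types Delta lam gam x : R.

Definition Phi x : R := fine (normal_prob (0 : R) 1 `]-oo, x]).

(* The value m(-lam), for lam > 0, of the Stieltjes transform of the
   Marchenko-Pastur law with ratio gam. *)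
Definition mMP gam lam : R :=
  (Num.sqrt ((gam + lam + 1) ^+ 2 - 4 * gam) + gam - lam - 1) / (2 * gam * lam).

(* The value m'(-lam), where m' is the derivative of m in its own argument
   zeta = - lam; hence the sign. *)
Definition dmMP gam lam : R := - derive1 (mMP gam) lam.

Definition gratio (gam0 gam1 : R) : R := gam0 * gam1 / (gam0 + gam1).

Definition gfun Delta (gam0 gam1 : R) (l : nat) : R :=
  - (1 / 2) * (Delta ^+ 2 + (-1) ^+ l * (gam1 - gam0)).

Definition kfun Delta (gam0 gam1 : R) : R := Num.sqrt (Delta ^+ 2 + gam0 + gam1).

Definition risk Delta lam (gam0 gam1 : R) : R :=
  let gam := gratio gam0 gam1 in
  1 / 2 * \sum_(l < 2)
    Phi ((gfun Delta gam0 gam1 l * mMP gam lam + (-1) ^+ l * ln (gam0 / gam1))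
         / (kfun Delta gam0 gam1 * Num.sqrt (dmMP gam lam))).

(* The factor 2 comes from gratio (2 * gam) (2 * gam) = gam. *)
Definition brisk Delta lam gam : R := risk Delta lam (2 * gam) (2 * gam).

Definition gam_crit Delta : R := Num.sqrt (Delta ^+ 2 + 4) / 2 + 1.

Definition quartic Delta (gam : R) : {poly R} :=
  let D2 := Delta ^+ 2 in
  let D4 := Delta ^+ 4 in
    (32 * gam + 4 * D2)%:P * 'X^4
  + (96 * gam ^+ 2 + 8 * gam * D2 + 128 * gam + 16 * D2)%:P * 'X^3
  + (96 * gam ^+ 3 + 112 * gam ^+ 2 + 16 * gam * D2 + 192 * gam + D4
     + 24 * D2)%:P * 'X^2
  + (- 8 * gam ^+ 3 * D2 - 16 * gam ^+ 2 * D2 + 32 * gam ^+ 4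
     - 96 * gam ^+ 3 - 64 * gam ^+ 2 - 2 * gam * D4 + 8 * gam * D2
     + 128 * gam + 2 * D4 + 16 * D2)%:P * 'X
  + (- 4 * gam ^+ 4 * D2 + 16 * gam ^+ 3 * D2 + gam ^+ 2 * D4
     - 16 * gam ^+ 2 * D2 - 16 * gam ^+ 4 + 64 * gam ^+ 3 - 80 * gam ^+ 2
     - 2 * gam * D4 + 32 * gam + D4 + 4 * D2)%:P.

Definition is_smallest_real_root (p : {poly R}) x : Prop :=
  root p x /\ forall y : R, root p y -> x <= y.

End Defs.

(* Main.v *)
(** Put [S = mpdisc g l = (g + l + 1)^2 - 4 g] and [s = mpsqrt g l = sqrt S],
    and let [a = mproot g l] be the positive root of
    [a^2 = (g - 1 - l) a + g l].  Then [m = a / (g l)] and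
    [m' = a (a + l) / (g l^2 s)], so that the squared signal-to-noise ratio
    [m^2 / (k m')] is the function [snr] below.  The logarithmic derivative of
    [snr] in [g], with [k = Delta^2 + 4 g], is a positive multiple of
    [F = signfun Delta g l = (Delta^2 + 4 g) (g - 1 - l) - 2 S (g + l + 1 + s)].

    At a balanced point the two summands of the risk contribute equally, up to
    terms of opposite sign, so the derivative of the risk along any curve
    through this point is a positive multiple of [- F] times the derivative of
    [gam0 + gam1]; this covers both derivatives in the theorem.

    Where [S >= 0], the quartic is the product of [F] and its conjugate under
    [s -> - s]; where [S < 0], it is positive.  For [1 < g < gam_crit], [F] is
    positive at [l = 0], negative at [l = g - 1] and strictly decreasing on
    [l >= 0]; on the left of its zero both factors are positive, hence this zero
    is the smallest real root of the quartic. *)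

Require Import Defs.
From HB Require Import structures.
From mathcomp Require Import all_boot all_order all_algebra.
From mathcomp Require Import all_classical all_reals all_analysis.
From mathcomp Require Import ring lra.

Import Order.TTheory GRing.Theory Num.Theory.
Import numFieldNormedType.Exports.

Local Open Scope classical_set_scope.
Local Open Scope ring_scope.

(** * Sign of the derivative: discriminant, [signfun] and the quartic *)

Section SignFunction.
Set Implicit Arguments.
Unset Strict Implicit.
Context {R : realType}.
Implicit Types Delta g l : R.

Definition mpdisc g l : R := (g + l + 1) ^+ 2 - 4 * g.

Definition mpsqrt g l : R := Num.sqrt (mpdisc g l).

Definition signfun Delta g l : R :=
  (Delta ^+ 2 + 4 * g) * (g - 1 - l)
  - 2 * mpdisc g l * (g + l + 1 + mpsqrt g l).

Lemma mpdisc_gt0 g l : 0 < g -> 0 < l -> 0 < mpdisc g l.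
Proof.
move=> g0 l0; have -> : mpdisc g l = (g - 1 - l) ^+ 2 + 4 * (g * l).
  by rewrite /mpdisc; ring.
by rewrite ltr_wpDl ?sqr_ge0// !mulr_gt0.
Qed.

Lemma mpdisc_ge0 g l : 0 < g -> 0 <= l -> 0 <= mpdisc g l.
Proof.
move=> g0; rewrite le_eqVlt => /predU1P[<-|l0]; last exact/ltW/mpdisc_gt0.
by have -> : mpdisc g 0 = (g - 1) ^+ 2 by [rewrite /mpdisc; ring]; rewrite sqr_ge0.
Qed.

Lemma mpsqrt_ge0 g l : 0 <= mpsqrt g l.
Proof. exact: sqrtr_ge0. Qed.

Lemma mpsqrt_gt0 g l : 0 < g -> 0 < l -> 0 < mpsqrt g l.
Proof. by move=> g0 l0; rewrite sqrtr_gt0 mpdisc_gt0. Qed.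

Lemma sqr_mpsqrt g l : 0 <= mpdisc g l -> mpsqrt g l ^+ 2 = mpdisc g l.
Proof. by move=> ?; rewrite sqr_sqrtr. Qed.

Lemma mpdisc_lt g l1 l2 : 0 < g -> 0 <= l1 -> l1 < l2 ->
  mpdisc g l1 < mpdisc g l2.
Proof.
move=> g0 l10 l12; rewrite ltrD2r ltrXn2r//; last first.
all: rewrite ?nnegrE; lra.
Qed.

(** On [l >= 0] the subtracted product has nonnegative increasing factors, and the affine term
    decreases in [l]. *)
Lemma signfun_decr Delta g l1 l2 : 0 < g -> 0 <= l1 -> l1 < l2 ->
  signfun Delta g l2 < signfun Delta g l1.
Proof.
move=> g0 l10 l12; rewrite /signfun ler_ltB//.
  by rewrite ler_wpM2l//; [rewrite addr_ge0 ?sqr_ge0//; lra|lra].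
have d12 := mpdisc_lt g0 l10 l12.
rewrite -!mulrA ltr_pM2l//; apply: ltr_pM => //.
- exact: mpdisc_ge0.
- by have := mpsqrt_ge0 g l1; lra.
- by rewrite ltr_leD// ?ler_sqrt ?(ltW d12)// ?(le_trans _ (ltW d12))
     ?mpdisc_ge0//; lra.
Qed.

(** Since [g - 1 - l <= 0], the first term cannot offset the positive product subtracted from it.
    This serves case (1) and, for [g] below [gam_crit], large [l]. *)
Lemma signfun_lt0_le Delta g l : 0 < g -> 0 < l -> g <= 1 + l ->
  signfun Delta g l < 0.
Proof.
move=> g0 l0 gl; rewrite /signfun subr_lt0.
apply: (@le_lt_trans _ _ 0).
  by rewrite mulr_ge0_le0 ?addr_ge0 ?sqr_ge0//; lra.
by rewrite !mulr_gt0 ?mpdisc_gt0//; have := mpsqrt_ge0 g l; lra.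
Qed.

(** At [l = 0] the discriminant is the square of [g - 1], so the radical disappears; the last factor
    changes sign exactly at [gam_crit]. *)
Lemma signfun0 Delta g : 1 <= g ->
  signfun Delta g 0 = (g - 1) * (Delta ^+ 2 + 4 - 4 * (g - 1) ^+ 2).
Proof.
move=> g1; rewrite /signfun /mpsqrt.
have -> : mpdisc g 0 = (g - 1) ^+ 2 by rewrite /mpdisc; ring.
by rewrite sqrtr_sqr ger0_norm ?subr_ge0//; ring.
Qed.

Lemma gam_crit_gt1 Delta : 1 < gam_crit Delta.
Proof.
by rewrite /gam_crit ltrDr divr_gt0// sqrtr_gt0 ltr_wpDl ?sqr_ge0.
Qed.

Lemma lt_gam_crit Delta g : 1 <= g ->
  (g < gam_crit Delta) = (4 * (g - 1) ^+ 2 < Delta ^+ 2 + 4).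
Proof.
move=> g1; have D0 : 0 <= Delta ^+ 2 + 4 by rewrite addr_ge0 ?sqr_ge0.
have -> : 4 * (g - 1) ^+ 2 = ((g - 1) * 2) ^+ 2 by ring.
rewrite /gam_crit -ltrBlDr ltr_pdivlMr// -[X in _ = (_ < X)](sqr_sqrtr D0).
by rewrite ltr_sqr ?nnegrE ?sqrtr_ge0//; lra.
Qed.

Lemma signfun_lt0_crit Delta g l : gam_crit Delta <= g -> 0 < l ->
  signfun Delta g l < 0.
Proof.
move=> gc l0; have g1 : 1 < g := lt_le_trans (gam_crit_gt1 Delta) gc.
apply: (lt_le_trans (signfun_decr Delta _ (lexx 0) l0)); first lra.
rewrite signfun0 ?(ltW g1)// mulr_ge0_le0//; first lra.
by rewrite subr_le0 leNgt -lt_gam_crit ?(ltW g1)// -leNgt.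
Qed.

(** This is the product of [signfun] and its conjugate with [s ^+ 2] replaced by [mpdisc], so it
    holds for every real [l]; where [mpdisc < 0] it is a square plus a positive number. *)
Lemma quarticE Delta g l : (quartic Delta g).[l] =
  ((Delta ^+ 2 + 4 * g) * (g - 1 - l)
    - 2 * mpdisc g l * (g + l + 1)) ^+ 2 - 4 * mpdisc g l ^+ 3.
Proof.
rewrite /quartic !(hornerD, hornerM, hornerC, hornerX, hornerXn) /mpdisc.
ring.
Qed.

Lemma quartic_factor Delta g l : 0 <= mpdisc g l ->
  (quartic Delta g).[l] = signfun Delta g l *
    (signfun Delta g l + 4 * mpdisc g l * mpsqrt g l).
Proof.
move=> d0; rewrite quarticE /signfun -!(sqr_mpsqrt d0); ring.
Qed.

(** Serves to exclude negative roots of the quartic. If [T = g + l + 1] is negative, then [s <= - T]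
    and the subtracted product is nonpositive; otherwise that product is at most its value at
    [l = 0], where [g < gam_crit Delta] gives positivity. *)
Lemma signfun_neg_gt0 Delta g l : 1 < g < gam_crit Delta -> l < 0 ->
  0 <= mpdisc g l -> 0 < signfun Delta g l.
Proof.
move=> /andP[g1 gc] l0 d0; move: gc; rewrite lt_gam_crit ?(ltW g1)// => gc.
have s0 := mpsqrt_ge0 g l; have sE := sqr_mpsqrt d0.
have c0 : 0 < (Delta ^+ 2 + 4 * g) * (g - 1 - l).
  by rewrite mulr_gt0 ?ltr_wpDl ?sqr_ge0//; lra.
rewrite /signfun; set T := g + l + 1; set s := mpsqrt g l in s0 sE *.
have TE : s ^+ 2 = T ^+ 2 - 4 * g by rewrite sE.
have [T0|T0] := ltP T 0.
  have sT : s <= - T by rewrite -ler_sqr ?nnegrE//; [rewrite sqrrN; lra|lra].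
  suff : 2 * mpdisc g l * (T + s) <= 0 by lra.
  by rewrite mulr_ge0_le0 ?mulr_ge0//; lra.
have Tg : T < g + 1 by rewrite /T; lra.
have dle : mpdisc g l <= (g - 1) ^+ 2.
  have : T ^+ 2 <= (g + 1) ^+ 2 by rewrite ler_sqr ?nnegrE//; lra.
  by rewrite -sE TE => ?; lra.
have sle : s <= g - 1 by rewrite -ler_sqr ?nnegrE//; [rewrite sE|lra].
rewrite subr_gt0; apply: (@le_lt_trans _ _ (2 * (g - 1) ^+ 2 * (2 * g))).
  by rewrite ler_pM ?mulr_ge0//; [lra|rewrite ler_pM2l|lra].
apply: (@lt_trans _ _ ((Delta ^+ 2 + 4 * g) * (g - 1))); last first.
  rewrite ltr_pM2l; first lra.
  by rewrite ltr_wpDl ?sqr_ge0//; lra.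
have -> : 2 * (g - 1) ^+ 2 * (2 * g)
          = (4 * (g - 1) ^+ 2 + 4 * (g - 1)) * (g - 1) by ring.
by rewrite ltr_pM2r; lra.
Qed.

Lemma signfun_continuous Delta g : continuous (signfun Delta g : R -> R).
Proof.
have cd : continuous (mpdisc g : R -> R).
  move=> l; apply: cvgD; last exact: cvg_cst.
  apply: (@continuous_comp _ _ _ (fun l => g + l + 1) (fun x => x ^+ 2)).
    by apply: cvgD; [apply: cvgD => //; exact: cvg_cst|exact: cvg_cst].
  exact: exprn_continuous.
move=> l; apply: cvgB.
  apply: cvgM; first exact: cvg_cst.
  by apply: cvgB => //; exact: cvg_cst.
apply: cvgM.
  by apply: cvgM; [exact: cvg_cst|exact: cd].
apply: cvgD.
  by apply: cvgD; [apply: cvgD => //; exact: cvg_cst|exact: cvg_cst].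
apply: (@continuous_comp _ _ _ (mpdisc g) Num.sqrt); first exact: cd.
exact: sqrt_continuous.
Qed.

Lemma signfun_root Delta g : 1 < g < gam_crit Delta ->
  exists2 x : R, 0 < x & signfun Delta g x = 0.
Proof.
move=> /andP[g1 gc].
have F0 : 0 < signfun Delta g 0.
  by rewrite signfun0 ?(ltW g1)// mulr_gt0 ?subr_gt0// -lt_gam_crit// ltW.
have F1 : signfun Delta g (g - 1) < 0 by apply: signfun_lt0_le; lra.
have [|||x] := @IVT R (signfun Delta g) 0 (g - 1) 0.
- lra.
- exact/continuous_subspaceT/signfun_continuous.
- by rewrite ge_min le_max (ltW F0) (ltW F1) orbT.
rewrite in_itv/= => /andP[x0 _] Fx; exists x => //.
rewrite lt_neqAle x0 andbT; apply/eqP => x0E; move: F0.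
by rewrite -x0E in Fx; rewrite Fx ltxx.
Qed.

Lemma signfun_root_smallest Delta g x : 1 < g < gam_crit Delta ->
  0 < x -> signfun Delta g x = 0 -> is_smallest_real_root (quartic Delta g) x.
Proof.
move=> gg x0 Fx; have g0 : 0 < g by move: gg => /andP[]; lra.
split.
  by apply/eqP; rewrite quartic_factor ?Fx ?mul0r// ltW// mpdisc_gt0.
move=> y ry; rewrite leNgt; apply/negP => yx.
suff : 0 < (quartic Delta g).[y] by rewrite (eqP ry) ltxx.
have [d0|d0] := leP 0 (mpdisc g y); last first.
  rewrite quarticE ltr_wpDl ?sqr_ge0// oppr_gt0 pmulr_rlt0//.
  by rewrite exprn_odd_lt0.
have Fy : 0 < signfun Delta g y.
  have [y0|y0] := leP 0 y; last exact: signfun_neg_gt0.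
  by rewrite -Fx signfun_decr.
rewrite quartic_factor// mulr_gt0// ltr_wpDr// !mulr_ge0// mpsqrt_ge0//.
Qed.

Lemma smallest_real_root_uniq (p : {poly R}) x y :
  is_smallest_real_root p x -> is_smallest_real_root p y -> x = y.
Proof.
by move=> [px xmin] [py ymin]; apply/le_anti; rewrite xmin// ymin.
Qed.

(** By uniqueness the smallest root is the positive zero of [signfun], and strict decrease turns the
    sign into a comparison with it. *)
Lemma signfun_lt0_smallest Delta g x l : 1 < g < gam_crit Delta -> 0 < l ->
  is_smallest_real_root (quartic Delta g) x ->
  (signfun Delta g l < 0) = (x < l).
Proof.
move=> gg l0 xmin; have g0 : 0 < g by move: gg => /andP[]; lra.
have [y y0 Fy] := signfun_root gg.
have -> : x = y.
  exact/(smallest_real_root_uniq xmin)/(signfun_root_smallest gg).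
have [yl|ly|yl] := ltgtP y l; last by rewrite -yl Fy ltxx.
  by rewrite -Fy signfun_decr// ltW.
by apply/negbTE; rewrite -leNgt -Fy ltW// signfun_decr// ltW.
Qed.

(** The threshold on [l] is uniform in [g], because monotonicity of the error requires the sign on a
    whole interval at one fixed [l]. The proof is the linear estimate
    [d - l * M <= signfun Delta g l] for [0 < l <= 1]. *)
Lemma signfun_gt0_near0 Delta (a b : R) : 1 < a -> a < b -> b < gam_crit Delta ->
  \forall l \near (0 : R)^'+, forall g, a <= g <= b -> 0 < signfun Delta g l.
Proof.
move=> a1 ab bc.
(* [d] bounds [signfun Delta g 0] from below on [[a, b]]: each factor is minimized at its own end of
   the interval. *)
pose d := (a - 1) * (Delta ^+ 2 + 4 - 4 * (b - 1) ^+ 2).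
(* [K] is chosen so that [s <= (g - 1) + K * l] for every [g] in [[a, b]]. *)
have [K K1 aK] : exists2 K, 1 <= K & (a - 1) * K = b + 1.
  exists ((b + 1) / (a - 1)); last by field; lra.
  by rewrite ler_pdivlMr; lra.
(* [M] adds the slope of the affine term, with [g <= b], to a bound on the terms in [l] of the
   expanded product. *)
pose M := Delta ^+ 2 + 4 * b
  + 2 * ((1 + K) * b ^+ 2 + (2 * b * K + K ^+ 2) * (2 * b + 1 + K)).
have d0 : 0 < d.
  rewrite mulr_gt0 ?subr_gt0// -lt_gam_crit//; lra.
have M0 : 0 < M.
  have : 0 <= Delta ^+ 2 by rewrite sqr_ge0.
  have : 0 <= (1 + K) * b ^+ 2 by rewrite mulr_ge0 ?sqr_ge0//; lra.
  have : 0 <= (2 * b * K + K ^+ 2) * (2 * b + 1 + K).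
    by rewrite mulr_ge0 ?addr_ge0 ?sqr_ge0 ?mulr_ge0//; lra.
  by rewrite /M; lra.
near=> l => g /andP[ag gb].
have l0 : 0 < l by near: l; exact: nbhs_right_gt.
have l1 : l <= 1 by near: l; exact: nbhs_right_le.
have lM : l * M < d.
  by rewrite -ltr_pdivlMr//; near: l; apply: nbhs_right_lt; rewrite divr_gt0.
have g0 : 0 < g by lra.
pose u := g - 1.
have uK : g + 1 <= u * K.
  apply: (@le_trans _ _ ((a - 1) * K)); first by rewrite aK; lra.
  by rewrite ler_wpM2r; rewrite /u; lra.
have ub : 0 <= u <= b by rewrite /u; lra.
(* Compared power by power in [l]: [g + 1 <= u * K] handles the linear term and [1 <= K] the
   quadratic one. *)
have sq : mpdisc g l <= (u + K * l) ^+ 2.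
  have -> : mpdisc g l = u ^+ 2 + l * (2 * (g + 1)) + l ^+ 2.
    by rewrite /mpdisc /u; ring.
  have -> : (u + K * l) ^+ 2 = u ^+ 2 + l * (2 * (u * K)) + (l * K) ^+ 2 by ring.
  rewrite lerD//; last by rewrite ler_sqr ?nnegrE ?ler_peMr ?mulr_ge0//; lra.
  by rewrite lerD// ler_wpM2l//; lra.
have ss : mpsqrt g l <= u + K * l.
  have u0 : 0 <= u + K * l by rewrite addr_ge0 ?mulr_ge0//; lra.
  rewrite -ler_sqr ?nnegrE ?mpsqrt_ge0// sqr_mpsqrt// ltW//.
  exact: mpdisc_gt0.
have u2 : u ^+ 2 <= b ^+ 2 by rewrite ler_sqr ?nnegrE; lra.
have sq2 : (u + K * l) ^+ 2 <= u ^+ 2 + l * (2 * b * K + K ^+ 2).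
  have -> : (u + K * l) ^+ 2 = u ^+ 2 + l * (2 * u * K + K ^+ 2 * l) by ring.
  rewrite lerD2l ler_wpM2l ?(ltW l0)// lerD//.
    by rewrite ler_wpM2r//; lra.
  by rewrite ler_piMr ?sqr_ge0.
have P : 2 * mpdisc g l * (g + l + 1 + mpsqrt g l) <=
    2 * ((u ^+ 2 + l * (2 * b * K + K ^+ 2)) * (2 * g + (1 + K) * l)).
  rewrite -mulrA ler_pM2l// ler_pM//.
  - exact/ltW/mpdisc_gt0.
  - by have := mpsqrt_ge0 g l; lra.
  - exact: le_trans sq sq2.
  - by move: ss; rewrite /u mulrDl mul1r; lra.
have Q : (u ^+ 2 + l * (2 * b * K + K ^+ 2)) * (2 * g + (1 + K) * l) <=
   2 * g * u ^+ 2 + l * ((1 + K) * b ^+ 2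
        + (2 * b * K + K ^+ 2) * (2 * b + 1 + K)).
  have C0 : 0 <= 2 * b * K + K ^+ 2 by rewrite addr_ge0 ?sqr_ge0 ?mulr_ge0//; lra.
  have Kl : (1 + K) * l <= 1 + K by rewrite ler_piMr//; lra.
  have h1 : l * ((1 + K) * u ^+ 2) <= l * ((1 + K) * b ^+ 2).
    by rewrite ler_pM2l// ler_pM2l//; lra.
  have h2 : l * ((2 * b * K + K ^+ 2) * (2 * g + (1 + K) * l)) <=
            l * ((2 * b * K + K ^+ 2) * (2 * b + 1 + K)).
    by rewrite ler_pM2l// ler_wpM2l//; lra.
  move: h1 h2; lra.
have dle : d <= (g - 1) * (Delta ^+ 2 + 4 - 4 * (g - 1) ^+ 2).
  have : (g - 1) ^+ 2 <= (b - 1) ^+ 2 by rewrite ler_sqr ?nnegrE; lra.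
  have : 0 < Delta ^+ 2 + 4 - 4 * (b - 1) ^+ 2.
    by rewrite subr_gt0 -lt_gam_crit//; lra.
  by move=> ? ?; rewrite /d ler_pM//; lra.
have E1 : (Delta ^+ 2 + 4 * g) * (g - 1 - l) - 4 * g * u ^+ 2 =
  (g - 1) * (Delta ^+ 2 + 4 - 4 * (g - 1) ^+ 2) - l * (Delta ^+ 2 + 4 * g).
  by rewrite /u; ring.
have E2 : l * (Delta ^+ 2 + 4 * g) <= l * (Delta ^+ 2 + 4 * b).
  by rewrite ler_pM2l// lerD2l; lra.
by move: lM P Q; rewrite /signfun /M; lra.
Unshelve. all: by end_near. Qed.

Lemma signfun_lt0_example Delta g : Delta ^+ 2 = 9 -> 0 < g ->
  signfun Delta g 1 < 0.
Proof.
move=> D9 g0.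
have [gc|gc] := leP (gam_crit Delta) g; first exact: signfun_lt0_crit.
have [g2|g2] := leP g (1 + 1); first exact: signfun_lt0_le.
move: gc; rewrite lt_gam_crit ?D9; last lra.
move=> gc; have {}gc : g < 3.
  rewrite ltNge; apply/negP => g3.
  have : 2 ^+ 2 <= (g - 1) ^+ 2 :> R by rewrite ler_sqr ?nnegrE; lra.
  by rewrite expr2; lra.
(* For [2 < g < 3] the first term is below [21], while [mpdisc g 1 = g ^+ 2 + 4 >= 8] and
   [g + 2 + s >= 4]. *)
rewrite /signfun subr_lt0 D9.
apply: (@lt_le_trans _ _ (2 * 8 * 4)).
  by apply: (@lt_trans _ _ (21 * 1)); [apply: ltr_pM; lra|lra].
have g22 : 2 * 2 <= g * g by rewrite ler_pM//; lra.
rewrite !ler_pM//; first by rewrite /mpdisc expr2; lra.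
by have := mpsqrt_ge0 g 1; lra.
Qed.

End SignFunction.

(** * Differentiation rules for real functions and the derivative of [Phi] *)

Section RealDerivatives.
Set Implicit Arguments.
Unset Strict Implicit.
Context {R : realType}.
Implicit Types (f g : R -> R) (x df dg : R).

Lemma derive1_is_derive f x df : is_derive x 1 f df -> derive1 f x = df.
Proof. by move=> fx; rewrite derive1E derive_val. Qed.

(** The rules from here on concern pointwise functions, so that they compose as explicit proof
    terms; [is_derive_eq] then simplifies the resulting value. *)
Lemma is_derive_cstf (c x : R) : is_derive x 1 (fun=> c) 0.
Proof. exact: is_derive_cst. Qed.

Lemma is_derive_idf x : is_derive x 1 (fun t : R => t) 1.
Proof. exact: is_derive_id. Qed.

Lemma is_derive_addf f g x df dg : is_derive x 1 f df -> is_derive x 1 g dg ->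
  is_derive x 1 (fun t => f t + g t) (df + dg).
Proof. by move=> fx gx; exact: is_deriveD. Qed.

Lemma is_derive_subf f g x df dg : is_derive x 1 f df -> is_derive x 1 g dg ->
  is_derive x 1 (fun t => f t - g t) (df - dg).
Proof. by move=> fx gx; exact: is_deriveB. Qed.

Lemma is_derive_mulf f g x df dg : is_derive x 1 f df -> is_derive x 1 g dg ->
  is_derive x 1 (fun t => f t * g t) (df * g x + f x * dg).
Proof.
move=> fx gx; apply: is_derive_eq (is_deriveM fx gx) _.
by rewrite addrC /GRing.scale/= [g x * df]mulrC.
Qed.

Lemma is_derive_divf f g x df dg :
  is_derive x 1 f df -> is_derive x 1 g dg -> g x != 0 ->
  is_derive x 1 (fun t => f t / g t) ((df * g x - f x * dg) / g x ^+ 2).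
Proof.
move=> fx gx gx0; apply: is_derive_eq (is_derive_mulf fx (is_deriveV gx0 gx)) _.
by rewrite /GRing.scale/=; field.
Qed.

Lemma is_derive_mull (c : R) f x df : is_derive x 1 f df ->
  is_derive x 1 (fun t => c * f t) (c * df).
Proof. by move=> fx; exact: is_deriveZ. Qed.

Lemma is_derive_sqrtf f x df : is_derive x 1 f df -> 0 < f x ->
  is_derive x 1 (fun t => Num.sqrt (f t)) (df / (2 * Num.sqrt (f x))).
Proof.
by move=> fx f0; rewrite mulrC; apply: is_derive1_comp; exact: is_derive1_sqrt.
Qed.

Lemma is_derive_lnf f x df : is_derive x 1 f df -> 0 < f x ->
  is_derive x 1 (fun t => ln (f t)) (df / f x).
Proof.
by move=> fx f0; rewrite mulrC; apply: is_derive1_comp; exact: is_derive1_ln.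
Qed.

(** Fundamental theorem of calculus for the continuous normal density; the upper bound [x + 1] keeps
    [x] interior. *)
Lemma is_derive1_Phi x : is_derive x 1 (@Phi R) (normal_pdf 0 1 x).
Proof.
have intpdf : (@lebesgue_measure R).-integrable `]-oo, (x + 1)]
    (EFin \o normal_pdf 0 1).
  by apply: (integrableS _ _ (@subsetT _ _)) => //; exact: integrable_normal_pdf.
have xx1 : x < x + 1 by rewrite ltrDl.
have [||dPhi PhiE] := continuous_FTC1 xx1 intpdf.
- by rewrite ltNyr.
- by apply: continuous_normal_pdf; rewrite oner_neq0.
by apply: DeriveDef => //; rewrite -derive1E.
Qed.

Lemma normal_pdf01_gt0 x : 0 < normal_pdf 0 1 x :> R.
Proof.
rewrite normal_pdfE ?oner_neq0// mulr_gt0 ?expR_gt0//.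
exact/normal_peak_gt0/oner_neq0.
Qed.

Lemma is_derive_Phif f x df : is_derive x 1 f df ->
  is_derive x 1 (fun t => Phi (f t)) (normal_pdf 0 1 (f x) * df).
Proof. by move=> fx; apply: is_derive1_comp; exact: is_derive1_Phi. Qed.

End RealDerivatives.

(** * Closed forms of the Stieltjes transform, its derivative and the signal-to-noise ratio *)

Section ClosedForms.
Set Implicit Arguments.
Unset Strict Implicit.
Context {R : realType}.
Implicit Types Delta g l k : R.

Definition mproot g l : R := (mpsqrt g l + g - l - 1) / 2.

(** [k] is a separate argument because off the diagonal [Delta ^+ 2 + gam0 + gam1] is not determined
    by the ratio [g]. *)
Definition snr g l k : R :=
  mproot g l * mpsqrt g l / (g * (mproot g l + l) * k).

(** Eliminates the square root in favour of [mproot], so that identities become rational and [field]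
    proves them modulo [mproot_eq]. *)
Lemma mpsqrtE g l : mpsqrt g l = 2 * mproot g l - g + l + 1.
Proof. by rewrite /mproot; field. Qed.

Lemma mproot_gt0 g l : 0 < g -> 0 < l -> 0 < mproot g l.
Proof.
move=> g0 l0; rewrite divr_gt0//.
have [gl|gl] := leP (l + 1) g; first by have := mpsqrt_gt0 g0 l0; lra.
suff : l + 1 - g < mpsqrt g l by lra.
rewrite -ltr_sqr ?nnegrE ?mpsqrt_ge0//; last lra.
rewrite sqr_mpsqrt ?mpdisc_ge0 1?ltW// -subr_gt0.
have -> : mpdisc g l - (l + 1 - g) ^+ 2 = 4 * (g * l) by rewrite /mpdisc; ring.
by rewrite !mulr_gt0.
Qed.

Lemma mproot_eq g l : 0 < g -> 0 < l ->
  mproot g l ^+ 2 = (g - 1 - l) * mproot g l + g * l.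
Proof.
move=> g0 l0; have := sqr_mpsqrt (mpdisc_ge0 g0 (ltW l0)).
rewrite mpsqrtE /mpdisc => E; apply/eqP; rewrite -subr_eq0; apply/eqP.
by move: E; set a := mproot g l; lra.
Qed.

Lemma mMPE g l : mMP g l = mproot g l / (g * l).
Proof.
rewrite /mMP /mproot /mpsqrt /mpdisc -[RHS]mulrA -invfM [2 * (g * l)]mulrA.
by congr (_ / _); ring.
Qed.

Lemma is_derive_mpsqrt_l g l : 0 < g -> 0 < l ->
  is_derive l 1 (mpsqrt g) ((g + l + 1) / mpsqrt g l).
Proof.
move=> g0 l0; have d0 := mpdisc_gt0 g0 l0; have s0 := mpsqrt_gt0 g0 l0.
have dd : is_derive l 1 (mpdisc g) (2 * (g + l + 1)).
  have aff := is_derive_addf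
    (is_derive_addf (is_derive_cstf g l) (is_derive_idf l)) (is_derive_cstf 1 l).
  apply: is_derive_eq
    (is_derive_subf (is_derive_mulf aff aff) (is_derive_cstf (4 * g) l)) _.
  by ring.
apply: is_derive_eq (is_derive_sqrtf dd d0) _.
by rewrite -/(mpsqrt g l); field; rewrite gt_eqF.
Qed.

Lemma is_derive_mpsqrt_g g l : 0 < g -> 0 < l ->
  is_derive g 1 (mpsqrt^~ l) ((g + l - 1) / mpsqrt g l).
Proof.
move=> g0 l0; have d0 := mpdisc_gt0 g0 l0; have s0 := mpsqrt_gt0 g0 l0.
have dd : is_derive g 1 (mpdisc^~ l) (2 * (g + l - 1)).
  have aff := is_derive_addf
    (is_derive_addf (is_derive_idf g) (is_derive_cstf l g)) (is_derive_cstf 1 g).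
  apply: is_derive_eq
    (is_derive_subf (is_derive_mulf aff aff) (is_derive_mull 4 (is_derive_idf g))) _.
  by ring.
apply: is_derive_eq (is_derive_sqrtf dd d0) _.
by rewrite -/(mpsqrt g l); field; rewrite gt_eqF.
Qed.

Lemma is_derive_mproot_l g l : 0 < g -> 0 < l ->
  is_derive l 1 (mproot g) ((g - mproot g l) / mpsqrt g l).
Proof.
move=> g0 l0; have s0 := mpsqrt_gt0 g0 l0; 
have ds := is_derive_addf (is_derive_mpsqrt_l g0 l0) (is_derive_cstf g l).
apply: is_derive_eq (is_derive_mulf (is_derive_subf (is_derive_subf ds
  (is_derive_idf l)) (is_derive_cstf 1 l)) (is_derive_cstf 2^-1 l)) _.
by rewrite /mproot; field; rewrite gt_eqF.
Qed.

Lemma is_derive_mproot_g g l : 0 < g -> 0 < l ->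
  is_derive g 1 (mproot^~ l) ((mproot g l + l) / mpsqrt g l).
Proof.
move=> g0 l0; have s0 := mpsqrt_gt0 g0 l0; 
have ds := is_derive_addf (is_derive_mpsqrt_g g0 l0) (is_derive_idf g).
apply: is_derive_eq (is_derive_mulf (is_derive_subf (is_derive_subf ds
  (is_derive_cstf l g)) (is_derive_cstf 1 g)) (is_derive_cstf 2^-1 g)) _.
by rewrite /mproot; field; rewrite gt_eqF.
Qed.

Lemma dmMPE g l : 0 < g -> 0 < l ->
  dmMP g l = mproot g l * (mproot g l + l) / (g * l ^+ 2 * mpsqrt g l).
Proof.
move=> g0 l0; have s0 := mpsqrt_gt0 g0 l0.
have gl0 : g * l != 0 by rewrite gt_eqF ?mulr_gt0.
have dm : is_derive l 1 (mMP g)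
    (- (mproot g l * (mproot g l + l) / (g * l ^+ 2 * mpsqrt g l))).
  rewrite (_ : mMP g = fun t => mproot g t / (g * t)); last first.
    by apply/funext => t; rewrite mMPE.
  apply: is_derive_eq (is_derive_divf (is_derive_mproot_l g0 l0)
    (is_derive_mull g (is_derive_idf l)) gl0) _.
  have E := mproot_eq g0 l0; move: s0; rewrite mpsqrtE => s0.
  field: E.
  by rewrite !gt_eqF.
by rewrite /dmMP (derive1_is_derive dm) opprK.
Qed.

Lemma snr_gt0 g l k : 0 < g -> 0 < l -> 0 < k -> 0 < snr g l k.
Proof.
move=> g0 l0 k0; have a0 := mproot_gt0 g0 l0; have s0 := mpsqrt_gt0 g0 l0.
have al0 := addr_gt0 a0 l0.
by apply: divr_gt0; rewrite mulr_gt0 ?(mulr_gt0 g0 al0).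
Qed.

(** Rewrites each argument of [Phi] in [risk] as [Num.sqrt snr] times its numerator divided by
    [mMP]. *)
Lemma sqrt_snrE g l k : 0 < g -> 0 < l -> 0 < k ->
  (Num.sqrt k * Num.sqrt (dmMP g l))^-1 = Num.sqrt (snr g l k) / mMP g l.
Proof.
move=> g0 l0 k0; have a0 := mproot_gt0 g0 l0; have s0 := mpsqrt_gt0 g0 l0.
have al0 : 0 < mproot g l + l by rewrite addr_gt0.
have m0 : 0 < mMP g l by rewrite mMPE divr_gt0// mulr_gt0.
have -> : snr g l k = mMP g l ^+ 2 * (k * dmMP g l)^-1.
  by rewrite /snr mMPE dmMPE//; field; rewrite !gt_eqF.
rewrite sqrtrM ?sqr_ge0// sqrtr_sqr gtr0_norm// mulrAC divff ?gt_eqF// mul1r.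
have dm0 : 0 < dmMP g l.
  rewrite dmMPE//; apply: divr_gt0; first exact: mulr_gt0.
  by rewrite mulr_gt0// mulr_gt0// exprn_gt0.
by rewrite sqrtrV ?sqrtrM// ltW// mulr_gt0.
Qed.

(** Meant for curves through a balanced point, with [gf] the ratio and [kf] equal to
    [Delta ^+ 2 + p + q]: there [p + q] and its derivative are four times the ratio and its
    derivative. *)
Lemma is_derive_snr Delta l (gf kf : R -> R) x dg :
  0 < l -> 0 < gf x -> kf x = Delta ^+ 2 + 4 * gf x ->
  is_derive x 1 gf dg -> is_derive x 1 kf (4 * dg) ->
  is_derive x 1 (fun t => snr (gf t) l (kf t))
    (dg * (snr (gf x) l (kf x) * (2 * signfun Delta (gf x) l) /
      ((gf x + l + 1 + mpsqrt (gf x) l) * mpdisc (gf x) l * kf x))).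
Proof.
move=> l0 g0 kE gx kx.
have k0 : 0 < kf x by rewrite kE ltr_wpDl ?sqr_ge0// mulr_gt0.
have a0 := mproot_gt0 g0 l0; have s0 := mpsqrt_gt0 g0 l0.
have al0 := addr_gt0 a0 l0.
have da : is_derive x 1 (fun t => mproot (gf t) l)
    ((mproot (gf x) l + l) / mpsqrt (gf x) l * dg).
  exact: is_derive1_comp (is_derive_mproot_g g0 l0) gx.
have ds : is_derive x 1 (fun t => mpsqrt (gf t) l)
    ((gf x + l - 1) / mpsqrt (gf x) l * dg).
  exact: is_derive1_comp (is_derive_mpsqrt_g g0 l0) gx.
have dn : gf x * (mproot (gf x) l + l) * kf x != 0.
  by rewrite gt_eqF// mulr_gt0// mulr_gt0.
apply: is_derive_eq (is_derive_divf (is_derive_mulf da ds)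
  (is_derive_mulf (is_derive_mulf gx
    (is_derive_addf da (is_derive_cstf l x))) kx) dn) _.
have E := mproot_eq g0 l0.
rewrite /snr /signfun -kE -(sqr_mpsqrt (mpdisc_ge0 g0 (ltW l0))).
move: s0; rewrite mpsqrtE => s0.
set a := mproot _ _ in a0 s0 al0 E *.
set k := kf x in k0 *. set g := gf x in g0 s0 E *.
clearbody a k g.
field: E.
by rewrite !gt_eqF//; lra.
Qed.

End ClosedForms.

(** * Derivative of the risk at balanced points, and monotonicity of the balanced error *)

Section RiskDerivative.
Set Implicit Arguments.
Unset Strict Implicit.
Context {R : realType}.
Implicit Types Delta g l p q : R.

(* The part of the argument of [Phi] whose sign depends on the class, after
   division by [mMP / (kfun * sqrt dmMP)]; see [riskE]. *)
Definition logratio l p q : R :=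
  (p - q) / 2 + ln (p / q) / (mproot (gratio p q) l / (gratio p q * l)).

Lemma gratio_gt0 p q : 0 < p -> 0 < q -> 0 < gratio p q.
Proof. by move=> p0 q0; rewrite divr_gt0 ?mulr_gt0 ?addr_gt0. Qed.

Lemma gratio_double g : 0 < g -> gratio (2 * g) (2 * g) = g.
Proof. by move=> g0; rewrite /gratio; field; rewrite !gt_eqF//; lra. Qed.

Lemma logratio_double l g : 0 < g -> logratio l (2 * g) (2 * g) = 0.
Proof.
by move=> g0; rewrite /logratio subrr divff ?ln1 ?mul0r ?addr0// gt_eqF// mulr_gt0.
Qed.

Lemma riskE Delta l p q : 0 < l -> 0 < p -> 0 < q ->
  let h := Num.sqrt (snr (gratio p q) l (Delta ^+ 2 + p + q)) in
  risk Delta l p q = 1 / 2 *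
    (Phi (h * (- (Delta ^+ 2 / 2) + logratio l p q)) +
     Phi (h * (- (Delta ^+ 2 / 2) - logratio l p q))).
Proof.
move=> l0 p0 q0 h; have g0 := gratio_gt0 p0 q0.
have k0 : 0 < Delta ^+ 2 + p + q by rewrite addr_gt0// ltr_wpDl ?sqr_ge0.
have m0 : 0 < mMP (gratio p q) l.
  by rewrite mMPE; apply: divr_gt0; [exact: mproot_gt0|exact: mulr_gt0].
rewrite /risk big_ord_recl big_ord1 /kfun sqrt_snrE//= -/h /gfun /logratio -mMPE.
by congr (_ * (Phi _ + Phi _)); rewrite ?expr0 ?expr1; field; rewrite gt_eqF.
Qed.

(** Product of the density at [h * c], of [- c] and of the derivative of [h] in [g] stripped of its
    factor [signfun], where [c = - (Delta ^+ 2 / 2)]. *)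
Definition risk_slope Delta g l : R :=
  let k := Delta ^+ 2 + 4 * g in
  let h := Num.sqrt (snr g l k) in
  normal_pdf 0 1 (h * - (Delta ^+ 2 / 2)) * (Delta ^+ 2 / 2) * h
    / ((g + l + 1 + mpsqrt g l) * mpdisc g l * k).

Lemma risk_slope_gt0 Delta g l : 0 < Delta -> 0 < g -> 0 < l ->
  0 < risk_slope Delta g l.
Proof.
move=> D0 g0 l0.
have k0 : 0 < Delta ^+ 2 + 4 * g by rewrite addr_gt0 ?exprn_gt0 ?mulr_gt0.
have d0 := mpdisc_gt0 g0 l0; have s0 := mpsqrt_gt0 g0 l0.
have D20 : 0 < Delta ^+ 2 / 2 by rewrite divr_gt0 ?exprn_gt0.
rewrite divr_gt0//.
  by rewrite !mulr_gt0 ?normal_pdf01_gt0 ?sqrtr_gt0 ?snr_gt0.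
by rewrite mulr_gt0// mulr_gt0// !addr_gt0.
Qed.

(** Only [dp + dq] enters, since on the diagonal the ratio has derivative [(dp + dq) / 4] and [k]
    has derivative [dp + dq]. *)
Lemma is_derive_risk Delta l g (p q : R -> R) x dp dq :
  0 < l -> 0 < g -> p x = 2 * g -> q x = 2 * g ->
  is_derive x 1 p dp -> is_derive x 1 q dq ->
  is_derive x 1 (fun t => risk Delta l (p t) (q t))
    ((dp + dq) / 4 * (risk_slope Delta g l * - signfun Delta g l)).
Proof.
move=> l0 g0 pE qE px qx.
have p0 : 0 < p x by rewrite pE mulr_gt0.
have q0 : 0 < q x by rewrite qE mulr_gt0.
have pq0 : p x + q x != 0 by rewrite gt_eqF// addr_gt0.
have gE : gratio (p x) (q x) = g by rewrite pE qE gratio_double.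
have dgr : is_derive x 1 (fun t => gratio (p t) (q t)) ((dp + dq) / 4).
  apply: is_derive_eq
    (is_derive_divf (is_derive_mulf px qx) (is_derive_addf px qx) pq0) _.
  by rewrite pE qE; field; rewrite !gt_eqF//; lra.
have dk : is_derive x 1 (fun t => Delta ^+ 2 + p t + q t) (4 * ((dp + dq) / 4)).
  apply: is_derive_eq
    (is_derive_addf (is_derive_addf (is_derive_cstf (Delta ^+ 2) x) px) qx) _.
  by field.
pose k := Delta ^+ 2 + 4 * g.
have kE : Delta ^+ 2 + p x + q x = k by rewrite pE qE /k; ring.
have k0 : 0 < k by rewrite ltr_wpDl ?sqr_ge0// mulr_gt0.
have H0 := snr_gt0 g0 l0 k0.
have dsnr := @is_derive_snr R Delta l (fun t => gratio (p t) (q t))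
  (fun t => Delta ^+ 2 + p t + q t) x _ l0.
rewrite /= gE kE in dsnr; have {}dsnr := dsnr _ g0 erefl dgr dk.
pose h t := Num.sqrt (snr (gratio (p t) (q t)) l (Delta ^+ 2 + p t + q t)).
have hE : h x = Num.sqrt (snr g l k) by rewrite /h gE kE.
have dh : is_derive x 1 h ((dp + dq) / 4 * (h x * signfun Delta g l
      / ((g + l + 1 + mpsqrt g l) * mpdisc g l * k))).
  apply: is_derive_eq (is_derive_sqrtf dsnr _) _; first by rewrite gE kE.
  rewrite gE kE -hE -[in X in X / _](sqr_sqrtr (ltW H0)) -hE.
  have h0 : 0 < h x by rewrite hE sqrtr_gt0.
  have d0 := mpdisc_gt0 g0 l0; have s0 := mpsqrt_gt0 g0 l0.
  by field; rewrite !gt_eqF// !addr_gt0.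
(* An unspecified [dv] suffices: [logratio] vanishes at [x], so both densities agree there and
   [h x * dv] enters the two summands with opposite signs. *)
have [dv dvP] : exists dv, is_derive x 1 (fun t => logratio l (p t) (q t)) dv.
  have da : is_derive x 1 (fun t => mproot (gratio (p t) (q t)) l)
     ((mproot (gratio (p x) (q x)) l + l) / mpsqrt (gratio (p x) (q x)) l
      * ((dp + dq) / 4)).
    exact: (is_derive1_comp (g := fun t => gratio (p t) (q t))
      (is_derive_mproot_g (gratio_gt0 p0 q0) l0) dgr).
  have n1 : gratio (p x) (q x) * l != 0 by rewrite gE gt_eqF// mulr_gt0.
  have n2 : mproot (gratio (p x) (q x)) l / (gratio (p x) (q x) * l) != 0.
    by rewrite gE gt_eqF// divr_gt0 ?mproot_gt0// mulr_gt0.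
  have n3 : 0 < p x / q x by rewrite divr_gt0.
  have dm := is_derive_divf da (is_derive_mulf dgr (is_derive_cstf l x)) n1.
  have dl := is_derive_lnf (is_derive_divf px qx (lt0r_neq0 q0)) n3.
  eexists; exact: is_derive_addf
    (is_derive_mulf (is_derive_subf px qx) (is_derive_cstf 2^-1 x))
    (is_derive_divf dl dm n2).
have v0 : logratio l (p x) (q x) = 0 by rewrite pE qE logratio_double.
pose c := - (Delta ^+ 2 / 2) : R.
have dX1 := is_derive_Phif
  (is_derive_mulf dh (is_derive_addf (is_derive_cstf c x) dvP)).
have dX2 := is_derive_Phif
  (is_derive_mulf dh (is_derive_subf (is_derive_cstf c x) dvP)).
have dX := is_derive_mull (1 / 2) (is_derive_addf dX1 dX2).
apply: near_eq_is_derive (is_derive_eq dX _) => //.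
  (* [riskE] requires [p t] and [q t] positive; continuity at [x] provides this nearby. *)
  have /differentiable_continuous pc : differentiable p x.
    exact/derivable1_diffP/ex_derive.
  have /differentiable_continuous qc : differentiable q x.
    exact/derivable1_diffP/ex_derive.
  near=> t; rewrite riskE//.
  - near: t; exact: cvgr_gt pc _ p0.
  - near: t; exact: cvgr_gt qc _ q0.
rewrite v0 addr0 subr0 /risk_slope -/k -hE -/c /c.
have d0 := mpdisc_gt0 g0 l0; have s0 := mpsqrt_gt0 g0 l0.
by field; rewrite !gt_eqF// !addr_gt0.
Unshelve. all: by end_near. Qed.

Lemma is_derive_brisk Delta l g : 0 < l -> 0 < g ->
  is_derive g 1 (brisk Delta l) (risk_slope Delta g l * - signfun Delta g l).
Proof.
move=> l0 g0; have d2 := is_derive_mull 2 (is_derive_idf g).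
apply: is_derive_eq (is_derive_risk Delta l0 g0 erefl erefl d2 d2) _.
by field.
Qed.

(** Here [dp + dq = 1], so the value is a quarter of the derivative of [brisk] and has the same
    sign. *)
Lemma is_derive_risk_balanced Delta l g : 0 < l -> 0 < g ->
  is_derive (2 * g) 1 (risk Delta l (2 * g))
    (1 / 4 * (risk_slope Delta g l * - signfun Delta g l)).
Proof.
move=> l0 g0; apply: is_derive_eq (is_derive_risk Delta l0 g0 _ _
  (is_derive_cstf (2 * g) (2 * g)) (is_derive_idf (2 * g))) _ => //.
by rewrite add0r.
Qed.

Lemma derive1_brisk_gt0 Delta l g : 0 < Delta -> 0 < l -> 0 < g ->
  (0 < derive1 (brisk Delta l) g) = (signfun Delta g l < 0).
Proof.
move=> D0 l0 g0; rewrite (derive1_is_derive (is_derive_brisk Delta l0 g0)).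
by rewrite pmulr_rgt0 ?risk_slope_gt0// oppr_gt0.
Qed.

Lemma derive1_brisk_lt0 Delta l g : 0 < Delta -> 0 < l -> 0 < g ->
  (derive1 (brisk Delta l) g < 0) = (0 < signfun Delta g l).
Proof.
move=> D0 l0 g0; rewrite (derive1_is_derive (is_derive_brisk Delta l0 g0)).
by rewrite pmulr_rlt0 ?risk_slope_gt0// oppr_lt0.
Qed.

Lemma derive1_risk_balanced_gt0 Delta l g : 0 < Delta -> 0 < l -> 0 < g ->
  (0 < derive1 (risk Delta l (2 * g)) (2 * g)) = (signfun Delta g l < 0).
Proof.
move=> D0 l0 g0; rewrite (derive1_is_derive (is_derive_risk_balanced Delta l0 g0)).
by rewrite pmulr_rgt0// pmulr_rgt0 ?risk_slope_gt0// oppr_gt0.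
Qed.

Lemma derivable_brisk Delta l g : 0 < l -> 0 < g ->
  derivable (brisk Delta l) g 1.
Proof. by move=> l0 g0; case: (is_derive_brisk Delta l0 g0). Qed.

Lemma brisk_within_continuous Delta l a b : 0 < l -> 0 < a ->
  {within `[a, b], continuous (brisk Delta l)}.
Proof.
move=> l0 a0; apply: derivable_within_continuous => x.
by rewrite in_itv/= => /andP[ax _]; apply: derivable_brisk; lra.
Qed.

Lemma brisk_lt Delta l x y : 0 < Delta -> 0 < l -> 0 < x -> x < y ->
  (forall g, x <= g <= y -> signfun Delta g l < 0) ->
  brisk Delta l x < brisk Delta l y.
Proof.
move=> D0 l0 x0 xy F; apply: (@gtr0_derive1_lt_cc _ _ x y) => //.
- by move=> z; rewrite in_itv/= => /andP[? _]; apply: derivable_brisk; lra.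
- move=> z; rewrite in_itv/= => /andP[xz zy]; rewrite derive1_brisk_gt0//; last lra.
  by apply: F; rewrite !ltW.
- exact: brisk_within_continuous.
- by rewrite in_itv/= lexx ltW.
- by rewrite in_itv/= lexx ltW.
Qed.

Lemma brisk_gt Delta l x y : 0 < Delta -> 0 < l -> 0 < x -> x < y ->
  (forall g, x <= g <= y -> 0 < signfun Delta g l) ->
  brisk Delta l y < brisk Delta l x.
Proof.
move=> D0 l0 x0 xy F; apply: (@ltr0_derive1_lt_cc _ _ x y) => //.
- by move=> z; rewrite in_itv/= => /andP[? _]; apply: derivable_brisk; lra.
- move=> z; rewrite in_itv/= => /andP[xz zy]; rewrite derive1_brisk_lt0//; last lra.
  by apply: F; rewrite !ltW.
- exact: brisk_within_continuous.
- by rewrite in_itv/= lexx ltW.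
- by rewrite in_itv/= lexx ltW.
Qed.

End RiskDerivative.

(** * From the sign of [signfun] to monotonicity and the absence of a phase transition *)

Theorem mainTheorem4 (R : realType) (Delta : R) (Delta_gt0 : 0 < Delta) :
  (* the derivatives below exist *)
  (forall lam gam : R, 0 < lam -> 0 < gam ->
     derivable (brisk Delta lam) gam 1 /\
     derivable (risk Delta lam (2 * gam)) (2 * gam) 1) /\
  (* the smallest real root in case (3) exists *)
  (forall gam : R, 1 < gam < gam_crit Delta ->
     exists x : R, is_smallest_real_root (quartic Delta gam) x) /\
  (* positive only in the cases (1), (2), (3) *)
  (forall lam gam : R, 0 < lam -> 0 < gam ->
     0 < derive1 (brisk Delta lam) gam ->
     [\/ 0 < gam <= 1,
         gam_crit Delta <= gam |
         1 < gam < gam_crit Delta /\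
         exists x : R, is_smallest_real_root (quartic Delta gam) x /\ x <= lam]) /\
  (* and conversely, except on the boundary lam = x of case (3) *)
  (forall lam gam : R, 0 < lam -> 0 < gam ->
     [\/ 0 < gam <= 1,
         gam_crit Delta <= gam |
         1 < gam < gam_crit Delta /\
         exists x : R, is_smallest_real_root (quartic Delta gam) x /\ x < lam] ->
     0 < derive1 (brisk Delta lam) gam) /\
  (* the balanced error increases on (0, 1) and on (gam_crit, +oo) *)
  (forall lam : R, 0 < lam ->
     {in `]0, 1[ &, {homo brisk Delta lam : x y / x < y}} /\
     {in `]gam_crit Delta, +oo[ &, {homo brisk Delta lam : x y / x < y}}) /\
  (* on (1, gam_crit): decreasing (locally uniformly) for small lam *)
  (forall a b : R, 1 < a -> a < b -> b < gam_crit Delta ->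
     \forall lam \near (0 : R)^'+,
       {in `[a, b] &, {homo brisk Delta lam : x y / x < y >-> y < x}}) /\
  (* on (1, gam_crit): increasing for large lam *)
  (\forall lam \near +oo,
     {in `]1, gam_crit Delta[ &, {homo brisk Delta lam : x y / x < y}}) /\
  (* no phase transition for large lam *)
  (\forall lam \near +oo, forall gam : R, 0 < gam ->
     0 < derive1 (risk Delta lam (2 * gam)) (2 * gam)) /\
  (* the example Delta ^ 2 = 9, lam = 1 *)
  (Delta ^+ 2 = 9 ->
     {in `]0, +oo[ &, {homo brisk Delta 1 : x y / x < y}} /\
     (forall gam0 : R, 0 < gam0 -> 0 < derive1 (risk Delta 1 gam0) gam0)).
Proof.
have c1 := gam_crit_gt1 Delta.
(* One threshold serves every [gam]: either [gam] is at least [gam_crit Delta], or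
   [gam < gam_crit Delta < lam] and the first term of [signfun] is negative. *)
have large lam gam : gam_crit Delta < lam -> 0 < gam -> signfun Delta gam lam < 0.
  move=> clam gam0; have [?|?] := leP (gam_crit Delta) gam.
    by apply: signfun_lt0_crit => //; lra.
  by apply: signfun_lt0_le; lra.
split.
  move=> lam gam lam0 gam0; split; first exact: derivable_brisk.
  by case: (is_derive_risk_balanced Delta lam0 gam0).
split.
  move=> gam gamI; have [x x0 Fx] := signfun_root gamI.
  by exists x; exact: signfun_root_smallest.
split.
  move=> lam gam lam0 gam0; rewrite derive1_brisk_gt0// => F.
  have [gam1|gam1] := leP gam 1; first by constructor 1; rewrite gam0.
  have [gamc|gamc] := leP (gam_crit Delta) gam; first by constructor 2.
  have gamI : 1 < gam < gam_crit Delta by rewrite gam1.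
  constructor 3; split => //; have [x x0 Fx] := signfun_root gamI.
  have xmin := signfun_root_smallest gamI x0 Fx.
  by exists x; split => //; rewrite ltW// -(signfun_lt0_smallest gamI).
split.
  move=> lam gam lam0 gam0; rewrite derive1_brisk_gt0//.
  case=> [/andP[_ gam1]|gamc|[gamI [x [xmin xlam]]]].
  - by apply: signfun_lt0_le => //; lra.
  - exact: signfun_lt0_crit.
  - by rewrite (signfun_lt0_smallest gamI lam0 xmin).
split.
  move=> lam lam0; split=> x y; rewrite !in_itv/=.
  - move=> /andP[x0 _] /andP[_ y1] xy; apply: brisk_lt => // g /andP[xg gy].
    by apply: signfun_lt0_le; lra.
  - rewrite !andbT => cx cy xy; apply: brisk_lt => //; first lra.
    by move=> g /andP[xg gy]; apply: signfun_lt0_crit => //; lra.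
split.
  move=> a b a1 ab bc; near=> lam => x y.
  have lam0 : 0 < lam by near: lam; exact: nbhs_right_gt.
  rewrite !in_itv/=.
  move=> /andP[ax xb] /andP[ay yb] xy; apply: brisk_gt => //.
  - lra.
  - have F : forall g, a <= g <= b -> 0 < signfun Delta g lam.
      by near: lam; exact: signfun_gt0_near0.
    by move=> g /andP[xg gy]; apply: F; rewrite (le_trans ax)// (le_trans gy).
split.
  near=> lam => x y; rewrite !in_itv/= => /andP[x1 _] _ xy.
  have clam : gam_crit Delta < lam.
    by near: lam; apply: nbhs_pinfty_gt; rewrite num_real.
  by apply: brisk_lt => // [|g /andP[xg _]]; [lra|apply: large => //; lra].
split.
  near=> lam => gam gam0.
  have clam : gam_crit Delta < lam.
    by near: lam; apply: nbhs_pinfty_gt; rewrite num_real.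
  have lam0 : 0 < lam by lra.
  by rewrite derive1_risk_balanced_gt0//; exact: large.
move=> D9; split=> [x y|gam0 gam00].
  rewrite !in_itv/= !andbT => x0 _ xy; apply: brisk_lt => // g /andP[xg _].
  by apply: signfun_lt0_example => //; lra.
(* The ratio at [gam1 = gam0] is [gam0 / 2]. *)
have -> : gam0 = 2 * (gam0 / 2) by field.
by rewrite derive1_risk_balanced_gt0 ?divr_gt0// signfun_lt0_example ?divr_gt0.
Unshelve. all: by end_near. Qed.
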